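(* Let $N$ be any odd positive integer. For every $k\in\mathbb{N}$ and every $x\in\mathbb{C}$ with $|x|\leq 1$, $$ \begin{aligned} & \sum_{\nu=1}^{k} \bigg\{ \sum_{\substack{m,n\geq 0 \\ m \equiv n\ (\mathrm{mod}\ N)}}\frac{x^n}{(n+1/2)^\nu(m+n+1)^{k+2-\nu}}\bigg\} +\sum_{\substack{m,n\geq 0 \\ m \equiv n\ (\mathrm{mod}\ N)}}\frac{x^n}{(m+1/2)(m+n+1)^{k+1}}\\ & \ +\sum_{\nu=1}^{k} \bigg\{ \sum_{\substack{m,n\geq 0 \\ m \equiv -2n-2\ (\mathrm{mod}\ N)}} \frac{x^n}{(n+1/2)^\nu(m+n+3/2)^{k+2-\nu}}\bigg\} + \sum_{\substack{m,n\geq 0 \\ m \equiv -2n-2\ (\mathrm{mod}\ N)}} \frac{x^n}{(m+1)(m+n+3/2)^{k+1}}\\ & \ - \sum_{\substack{m,n\geq 0 \\ m \equiv -2n-2\ (\mathrm{mod}\ N)}} \frac{x^{m+n+1}}{(m+1)(m+n+3/2)^{k+1}} - \sum_{\substack{m,n\geq 0 \\ m \equiv -2n-2\ (\mathrm{mod}\ N)}} \frac{x^{m+n+1}}{(n+1/2)(m+n+3/2)^{k+1}}\\ & =\frac{x^{(N-1)/2}}{N^{k+2}}\sum_{n\geq 0} \frac{x^{Nn}}{(n+1/2)^{k+2}}+\frac{\pi}{N}\sum_{\substack{m\geq 0\\ N\nmid (2m+1)}} \frac{x^m}{\sin((2m+1)\pi/N)\,(m+1/2)^{k+1}}. \end{aligned}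 $$
   Context: $\mathbb{N}$ is the set of positive integers; the summation variables $m,n$ are integers. The convention $x^0=1$ is used (also for $x=0$), and empty sums are $0$. *)

(* Defs.v *)
From HB Require Import structures.
From mathcomp Require Import all_boot all_order all_algebra.
From mathcomp Require Import complex.
From mathcomp Require Import all_classical all_reals all_analysis.
From mathcomp Require summability.

Set Implicit Arguments.
Unset Strict Implicit.
Unset Printing Implicit Defensive.

Import Order.TTheory GRing.Theory Num.Theory.
Import numFieldNormedType.Exports.

Local Open Scope classical_set_scope.
Local Open Scope ring_scope.

(* The regular module [R[i]^o] carries the usual topology of the complex
   plane: it is normed by the modulus, seen as an element of [R[i]].
   Convergence along [totally], the filter of finite subsets of [I] ordered by
   inclusion, is unconditional convergence, which for complex families is the
   same as absolute convergence. *)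
Definition csummable (R : realType) (I : choiceType) (u : I -> R[i]) : Prop :=
  cvg (summability.partial_sum (u : I -> R[i]^o) @ summability.totally).

(* Meaningful only when [csummable u] holds. *)
Definition csum (R : realType) (I : choiceType) (u : I -> R[i]) : R[i] :=
  summability.sum (u : I -> R[i]^o).

Definition restr1 (R : realType) (P : nat -> bool) (F : nat -> R[i]) :
  nat -> R[i] := fun n => if P n then F n else 0.

Definition restr2 (R : realType) (P : nat -> nat -> bool)
  (F : nat -> nat -> R[i]) : nat * nat -> R[i] :=
  fun p => if P p.1 p.2 then F p.1 p.2 else 0.

(* The congruences are between integers. *)
Definition mod_diag (N m n : nat) : bool := (m%:Z == n%:Z %[mod N%:Z])%Z.

Definition mod_anti (N m n : nat) : bool :=
  (m%:Z == - (2 * n%:Z) - 2 %[mod N%:Z])%Z.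

(* Main.v *)
(* Both sides are power series in x, and it suffices to compare coefficients.
   Write a = j + 1/2. Summing the coefficient of x^j in the first four families
   by partial fractions leaves a^-(k+1) times the differences
   1/(m + 1/2) - 1/(m + j + 1) over m = j (mod N) and
   1/(m + 1) - 1/(m + j + 3/2) over m = -2j - 2 (mod N). Up to
   finitely many terms, which are those of the last two families (and the
   single term 1/a when N divides 2j + 1), these are the series over residue
   classes whose sums are given by
     sum_{t >= 0} (1/(s + t) - 1/(1 - s + t)) = pi cot(pi s),
   at s = (2j + 1)/(2N) and s = (2j + 1)/N; then cot z - cot 2z = 1/sin 2z.

   The cotangent series comes from iterating cot z + cot (z + pi/2) = 2 cot 2z:
   pi cot(pi s) is a mean of cotangents at 2^(m+1) equidistant points, and
   replacing cot y by 1/y costs at most 2^-m because 1/y - cot y is monotone on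
   [0, pi/2]. Only the partial sums of length N * 2^m are therefore controlled,
   which is enough because every double series converges unconditionally. *)

Require Import Defs.
From HB Require Import structures.
From mathcomp Require Import all_boot all_order all_algebra.
From mathcomp Require Import finmap complex.
From mathcomp Require Import all_classical all_reals all_analysis.
From mathcomp Require summability.
From mathcomp Require Import ring lra zify.

Set Implicit Arguments.
Unset Strict Implicit.
Unset Printing Implicit Defensive.

Import Order.TTheory GRing.Theory Num.Theory.
Import numFieldNormedType.Exports.

Local Open Scope classical_set_scope.
Local Open Scope complex_scope.
Local Open Scope ring_scope.

(** * Unconditional sums *)

#[local] Existing Instance summability.totally_filter.

(** Relational form of [csum]: existence and value of a sum travel together through the linear
    operations below. *)
Definition has_csum (R : realType) (I : choiceType) (u : I -> R[i])
    (l : R[i]) : Prop :=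
  summability.partial_sum (u : I -> R[i]^o) @ summability.totally
    --> (l : R[i]^o).

Lemma partial_sumE (V : zmodType) (I : choiceType) (u : I -> V)
    (A : {fset I}) : summability.partial_sum u A = \sum_(i <- A) u i.
Proof. by rewrite /summability.partial_sum -(big_seq_fsetE _ A predT u). Qed.

Lemma csummable_has_csum (R : realType) (I : choiceType) (u : I -> R[i]) :
  csummable u -> has_csum u (csum u).
Proof. by []. Qed.

Lemma has_csum_csummable (R : realType) (I : choiceType) (u : I -> R[i]) l :
  has_csum u l -> csummable u.
Proof. by move=> ul; apply/cvg_ex; exists l. Qed.

Lemma eq_has_csum (R : realType) (I : choiceType) (u v : I -> R[i]) l :
  u =1 v -> has_csum u l -> has_csum v l.
Proof. by move=> /funext ->. Qed.

Lemma has_csumD (R : realType) (I : choiceType) (u v : I -> R[i]) l l' :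
  has_csum u l -> has_csum v l' -> has_csum (fun i => u i + v i) (l + l').
Proof.
move=> ul vl; rewrite /has_csum.
have -> : summability.partial_sum ((fun i => u i + v i) : I -> R[i]^o) =
   summability.partial_sum (u : I -> R[i]^o) \+
   summability.partial_sum (v : I -> R[i]^o).
  by apply/funext => A /=; rewrite !partial_sumE big_split.
exact: (cvgD ul vl).
Qed.

Lemma has_csumZ (R : realType) (I : choiceType) (c : R[i]) (u : I -> R[i]) l :
  has_csum u l -> has_csum (fun i => c * u i) (c * l).
Proof.
move=> ul; rewrite /has_csum.
have -> : summability.partial_sum ((fun i => c * u i) : I -> R[i]^o) =
   (fun A => c *: summability.partial_sum (u : I -> R[i]^o) A).
  by apply/funext => A /=; rewrite !partial_sumE /GRing.scale/= big_distrr.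
exact: (cvgZr ul).
Qed.

Lemma has_csum0 (R : realType) (I : choiceType) :
  has_csum (fun _ : I => 0 : R[i]) 0.
Proof.
rewrite /has_csum.
have -> : summability.partial_sum ((fun=> 0) : I -> R[i]^o) = (fun=> 0).
  by apply/funext => A /=; rewrite partial_sumE big1.
exact: cvg_cst.
Qed.

Lemma has_csum_sum (R : realType) (I : choiceType) (a b : nat)
    (u : nat -> I -> R[i]) (l : nat -> R[i]) :
  (forall j, (a <= j < b)%N -> has_csum (u j) (l j)) ->
  has_csum (fun i => \sum_(a <= j < b) u j i) (\sum_(a <= j < b) l j).
Proof.
elim: b => [|b IH] ul.
  apply: (@eq_has_csum _ _ (fun=> 0)); last first.
    by rewrite big_geq//; exact: has_csum0.
  by move=> i; rewrite big_geq.
have [ab|ba] := leqP a b; last first.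
  rewrite big_geq//; apply: (@eq_has_csum _ _ (fun=> 0)); last exact: has_csum0.
  by move=> i; rewrite big_geq.
rewrite big_nat_recr//=.
apply: (@eq_has_csum _ _ (fun i => \sum_(a <= j < b) u j i + u b i)).
  by move=> i; rewrite big_nat_recr.
apply: has_csumD; last by apply: ul; rewrite ab leqnn.
by apply: IH => j /andP[aj jb]; apply: ul; rewrite aj ltnW.
Qed.

(** Duplicate-free lists replace finite sets, so that intervals, rectangles and triangles of indices
    can be used directly. *)
Lemma has_csum_near (R : realType) (I : choiceType) (u : I -> R[i]) l
    (e : R[i]) : has_csum u l -> 0 < e ->
  exists A : seq I, forall s : seq I, uniq s -> {subset A <= s} ->
    `|l - \sum_(i <- s) u i| < e.
Proof.
move=> /cvgrPdist_lt ul e0; have [A _ Ae] := ul e e0.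
exists (enum_fset A) => s us As.
have := Ae [fset x in s]%fset.
rewrite /= partial_sumE => H.
have <- : \sum_(i <- [fset x in s]%fset) u i = \sum_(i <- s) u i.
  apply: perm_big; apply: uniq_perm => //.
  by move=> x; rewrite in_fset/=.
apply: H; apply/fsubsetP => x xA.
by rewrite in_fset/=; exact: As.
Qed.

Lemma subset_exhaustion (I : eqType) (s : nat -> seq I) (A : seq I) :
  (forall x, exists n0, forall n, (n0 <= n)%N -> x \in s n) ->
  exists n0, forall n, (n0 <= n)%N -> {subset A <= s n}.
Proof.
move=> xs; elim: A => [|x A [n0 IH]]; first by exists 0%N.
have [n1 H1] := xs x; exists (maxn n0 n1) => n.
rewrite geq_max => /andP[h0 h1] y; rewrite inE => /orP[/eqP->|yA].
  exact: H1.
exact: IH yA.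
Qed.

(** The lists [s n] need not be nested: each index is eventually always present, hence so is every
    finite set of indices. *)
Lemma has_csum_seq (R : realType) (I : choiceType) (u : I -> R[i]) l
    (s : nat -> seq I) :
  has_csum u l -> (forall n, uniq (s n)) ->
  (forall x, exists n0, forall n, (n0 <= n)%N -> x \in s n) ->
  ((\sum_(i <- s n) u i : R[i]^o) @[n --> \oo] --> (l : R[i]^o)).
Proof.
move=> ul us xs; apply/cvgrPdist_lt => e e0.
have [A HA] := has_csum_near ul e0.
have [n0 Hn0] := subset_exhaustion A xs.
near=> n; apply: HA => //; apply: Hn0; near: n; exact: nbhs_infty_ge.
Unshelve. all: by end_near. Qed.

(* Letting [M] tend to infinity in the sums over [m < M, n < L] turns
   summability over pairs into convergence of the series of row sums. *)
Lemma has_csum_rows (R : realType) (u : nat * nat -> R[i]) l (v : nat -> R[i])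
    (phi : nat -> nat) :
  has_csum u l -> phi @ \oo --> \oo ->
  (forall n, (\sum_(0 <= m < phi i) u (m, n) : R[i]^o) @[i --> \oo]
     --> (v n : R[i]^o)) ->
  ((\sum_(0 <= n < L) v n : R[i]^o) @[L --> \oo] --> (l : R[i]^o)).
Proof.
move=> ul phioo uv; apply/cvgrPdist_lt => e e0.
have e20 : 0 < e / 2 by rewrite divr_gt0.
have [A HA] := has_csum_near ul e20.
(* The square of side [L0] at the origin contains [A]. *)
pose L0 := \max_(p <- A) (maxn p.1 p.2).+1.
have AL0 m n : (m, n) \in A -> (m < L0)%N /\ (n < L0)%N.
  move=> mnA; have /= : (maxn m n < L0)%N.
    exact: (@leq_bigmax_seq _ A xpredT
      (fun p : nat * nat => (maxn p.1 p.2).+1) (m, n) mnA isT).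
  by rewrite gtn_max => /andP[].
have sumv L : (\sum_(0 <= n < L) \sum_(0 <= m < phi i) u (m, n) : R[i]^o)
    @[i --> \oo] --> (\sum_(0 <= n < L) v n : R[i]^o).
  elim: L => [|K IH].
    by rewrite big_nil; apply: cvg_near_cst; near=> i; rewrite big_nil.
  rewrite (big_nat_recr _ _ _ (leq0n K)).
  rewrite (_ : (fun i => _) = (fun i => \sum_(0 <= n < K)
     \sum_(0 <= m < phi i) u (m, n) + \sum_(0 <= m < phi i) u (m, K))).
    exact: (cvgD IH (uv K)).
  by apply/funext => i; rewrite (big_nat_recr _ _ _ (leq0n K)).
near=> L.
have LL0 : (L0 <= L)%N by near: L; exact: nbhs_infty_ge.
(* With [L] now fixed, [i] is taken so large that the truncated rows are within [e / 2] of the sum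
   of the [v n] and the rectangle contains [A]. *)
have /cvgrPdist_lt/(_ _ e20) F1 := sumv L.
have F2 : \forall i \near \oo, (L0 <= phi i)%N.
  by apply: (phioo [set n | (L0 <= n)%N]); exact: nbhs_infty_ge.
have [i [/= iv iL]] := filter_ex (filterI F1 F2).
have : `|l - \sum_(0 <= n < L) \sum_(0 <= m < phi i) u (m, n)| < e / 2.
  have := HA [seq (m, n) | n <- index_iota 0 L, m <- index_iota 0 (phi i)].
  rewrite big_allpairs_dep; apply.
    apply: allpairs_uniq; rewrite ?iota_uniq//.
    by move=> [a b] [c d] _ _ /= [-> ->].
  move=> [m n] /AL0[mL nL]; apply/allpairsP; exists (n, m) => /=.
  by rewrite !mem_index_iota /= (leq_trans mL)// (leq_trans nL).
move=> H; rewrite -(subrKA (\sum_(0 <= n < L) \sum_(0 <= m < phi i) u (m, n))).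
rewrite (le_lt_trans (ler_normD _ _))// [ltRHS](splitr e) ltrD//.
by rewrite distrC.
Unshelve. all: by end_near. Qed.

(** * Criteria for absolute summability *)

Lemma norm_real_complex (R : rcfType) (x : R) : `|x%:C| = `|x|%:C :> R[i].
Proof. by rewrite normc_def /= expr0n addr0 sqrtr_sqr. Qed.

(** Partial sums of a nonnegative family increase with the finite set, so they converge to their
    supremum. *)
Lemma cvg_partial_sum_ge0 (R : realType) (I : choiceType) (v : I -> R)
    (M : R) : (forall i, 0 <= v i) ->
  (forall A : {fset I}, \sum_(i <- A) v i <= M) ->
  cvg (summability.partial_sum v @ summability.totally).
Proof.
move=> v0 vM.
pose E := range (fun A : {fset I} => \sum_(i <- A) v i).
have supE : has_sup E.
  split; first by exists (\sum_(i <- fset0) v i); exists fset0.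
  by exists M => _ [A _ <-].
have le_sum (A B : {fset I}) : (A `<=` B)%fset ->
    \sum_(i <- A) v i <= \sum_(i <- B) v i.
  move=> AB; rewrite [leRHS](big_fsetID _ (mem A))/=.
  rewrite (_ : [fset x in B | x \in A]%fset = A) ?lerDl ?sumr_ge0//.
  apply/fsetP => i; rewrite !inE/= andbC; case: (boolP (i \in A)) => //= iA.
  exact: (fsubsetP AB).
apply/cvg_ex; exists (sup E); apply/cvgrPdist_lt => e e0.
have [_ [A _ <-] eA] := sup_adherent e0 supE.
exists A => // B /= AB; rewrite partial_sumE.
have EB : \sum_(i <- B) v i <= sup E.
  by apply: ub_le_sup; [case: supE|exists B].
rewrite ger0_norm ?subr_ge0// ltrBlDl -ltrBlDr.
by rewrite (lt_le_trans eA)// le_sum.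
Qed.

Lemma cvg_real_complex (R : realType) (T : Type) (F : set_system T)
    (FF : Filter F) (f : T -> R) (l : R) : f @ F --> l ->
  ((f t)%:C : R[i]^o) @[t --> F] --> (l%:C : R[i]^o).
Proof.
move=> /cvgrPdist_lt fl; apply/cvgrPdist_lt => e e0.
(* In the partial order on [R[i]], a positive [e] is automatically real. *)
have eE : e = (complex.Re e)%:C by rewrite RRe_real// gtr0_real.
have := fl (complex.Re e); rewrite -ltcR -eE => /(_ e0).
apply: filterS => t; rewrite -ltcR -eE; apply: le_lt_trans.
by rewrite -rmorphB norm_real_complex lexx.
Qed.

Lemma csummable_real_ge0 (R : realType) (I : choiceType) (v : I -> R)
    (M : R) : (forall i, 0 <= v i) ->
  (forall A : {fset I}, \sum_(i <- A) v i <= M) ->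
  csummable (fun i => (v i)%:C).
Proof.
move=> v0 vM; have /cvg_ex[l vl] := cvg_partial_sum_ge0 v0 vM.
apply/cvg_ex; exists l%:C.
rewrite (_ : summability.partial_sum _ = (fun A : {fset I} =>
  (summability.partial_sum v A)%:C : R[i]^o)); first exact: cvg_real_complex.
by apply/funext => A; rewrite !partial_sumE rmorph_sum.
Qed.

(** The positive and negative parts of the real and imaginary parts of [u] are nonnegative and
    dominated by the modulus, so each is summable; [u] is a linear combination of these four
    families. *)
Lemma csummable_bounded (R : realType) (I : choiceType) (u : I -> R[i])
    (M : R) (s : nat -> seq I) :
  (forall n, uniq (s n)) ->
  (forall x, exists n0, forall n, (n0 <= n)%N -> x \in s n) ->
  (forall n, \sum_(i <- s n) `|u i| <= M%:C) -> csummable u.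
Proof.
move=> us xs uM.
pose w i := complex.Re `|u i|.
have wE i : `|u i| = (w i)%:C by rewrite RRe_real// normr_real.
have w0 i : 0 <= w i by rewrite -lecR -wE normr_ge0.
(* Every finite set lies in some [s n], and enlarging it only adds nonnegative terms. *)
have wM (A : {fset I}) : \sum_(i <- A) w i <= M.
  have [n /(_ n (leqnn n)) An] := subset_exhaustion (enum_fset A) xs.
  have := uM n; under eq_bigr do rewrite wE.
  rewrite -rmorph_sum lecR; apply: le_trans.
  rewrite [leRHS](bigID (mem A))/= -[leLHS]addr0 lerD ?sumr_ge0//.
  rewrite -[leRHS]big_filter (perm_big [seq x <- s n | x \in A])//=.
  apply: uniq_perm; rewrite ?filter_uniq//.
  move=> x; rewrite mem_filter/=; case: (boolP (x \in A)) => //= xA.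
  by rewrite An.
have H (v : I -> R) : (forall i, 0 <= v i <= w i) ->
    has_csum (fun i => (v i)%:C) (csum (fun i => (v i)%:C)).
  move=> vw; apply: csummable_has_csum; apply: (@csummable_real_ge0 _ _ _ M).
    by move=> i; case/andP: (vw i).
  move=> A; apply: (le_trans _ (wM A)); apply: ler_sum => i _.
  by case/andP: (vw i).
have Re_le i : `|complex.Re (u i)| <= w i.
  by rewrite -lecR -wE normc_ge_Re.
have Im_le i : `|complex.Im (u i)| <= w i.
  by rewrite -lecR -wE normc_def lecR -sqrtr_sqr ler_wsqrtr// lerDr sqr_ge0.
have pos_part (x y : R) : `|x| <= y -> 0 <= Num.max x 0 <= y.
  rewrite le_max lexx orbT ge_max/= => xy.
  by rewrite (le_trans (ler_norm x))//= (le_trans _ xy).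
have partE (x : R) : x = Num.max x 0 - Num.max (- x) 0.
  have [x0|x0] := leP x 0.
    by rewrite max_l ?oppr_ge0// sub0r opprK.
  by rewrite max_r ?subr0// oppr_le0 ltW.
have H1 := H _ (fun i => pos_part _ _ (Re_le i)).
have H2 := H (fun i => Num.max (- complex.Re (u i)) 0)
  (fun i => pos_part _ _ (etrans (congr1 (<= w i) (normrN _)) (Re_le i))).
have H3 := H _ (fun i => pos_part _ _ (Im_le i)).
have H4 := H (fun i => Num.max (- complex.Im (u i)) 0)
  (fun i => pos_part _ _ (etrans (congr1 (<= w i) (normrN _)) (Im_le i))).
have := has_csumD (has_csumD H1 (has_csumZ (c := -1) H2))
  (has_csumZ (c := 'i%C) (has_csumD H3 (has_csumZ (c := -1) H4))).
move=> /(eq_has_csum _); move=> /(_ u) K; apply: has_csum_csummable (K _).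
move=> i; rewrite !mulN1r -!rmorphB -!partE.
by rewrite [RHS]complexE.
Qed.

(** Telescoping at half-integers: [((z + 1) ^+ 2)^-1] is at most [((z + 1) ^+ 2 - 1 / 4)^-1], which
    is the difference of the inverses of [z + 1 / 2] and [z + 3 / 2]. *)
Lemma sum_invr_sqr_le (R : realFieldType) (n L : nat) :
  \sum_(0 <= m < L) ((m + n).+1%:R ^+ 2)^-1 <= 2 / n.+1%:R :> R.
Proof.
suff H : \sum_(0 <= m < L) ((m + n).+1%:R ^+ 2)^-1
    <= (n%:R + 1 / 2)^-1 - ((L + n)%:R + 1 / 2)^-1 :> R.
  apply: (le_trans H); have n0 : 0 <= n%:R :> R by [].
  apply: (@le_trans _ _ ((n%:R + 1 / 2)^-1)).
    by rewrite gerBl invr_ge0; have := ler0n R (L + n); lra.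
  rewrite -[leRHS]invf_div ler_pV2 ?inE ?unitfE; last 2 first.
  - by apply/andP; split; [apply/eqP; lra|lra].
  - by rewrite -natr1; apply/andP; split; [apply/eqP; lra|lra].
  by rewrite -natr1; lra.
elim: L => [|L IH]; first by rewrite big_nil add0n subrr.
rewrite big_nat_recr//= addSn -[(L + n).+1%:R]natr1.
set z := (L + n)%:R in IH *; have z0 : 0 <= z :> R by [].
suff H : ((z + 1) ^+ 2)^-1 <= (z + 1 / 2)^-1 - (z + 1 + 1 / 2)^-1.
  by move: (lerD IH H); lra.
have -> : (z + 1 / 2)^-1 - (z + 1 + 1 / 2)^-1 =
    ((z + 1) ^+ 2 - 1 / 4)^-1.
  by field; apply/and3P; split; apply/eqP; nra.
by rewrite ler_pV2 ?inE ?unitfE; [lra|apply/andP; split; [apply/eqP|]; nra..].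
Qed.

Lemma csummable_nat (R : realType) (C : R) (u : nat -> R[i]) :
  0 <= C -> (forall n, `|u n| <= (C / n.+1%:R ^+ 2)%:C) -> csummable u.
Proof.
move=> C0 uC; apply: (@csummable_bounded _ _ _ (C * 2) (iota 0)).
- by move=> n; exact: iota_uniq.
- by move=> x; exists x.+1 => n; rewrite mem_iota.
move=> n; apply: (@le_trans _ _ (\sum_(i <- iota 0 n) (C / i.+1%:R ^+ 2)%:C)).
  by apply: ler_sum => i _.
rewrite -rmorph_sum lecR -big_distrr/= ler_wpM2l//.
have := sum_invr_sqr_le R 0 n; rewrite divr1; apply: le_trans.
rewrite /index_iota subn0.
by under [leRHS]eq_bigr do rewrite addn0.
Qed.

(** [sum_invr_sqr_le] is used twice: the sum over [m] is at most [2 / n.+1%:R], which leaves twice a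
    sum of inverse squares over [n]. *)
Lemma sum_pair_bound (R : realFieldType) (L : nat) :
  \sum_(0 <= n < L) \sum_(0 <= m < L) (n.+1%:R * (m + n).+1%:R ^+ 2)^-1
    <= 4 :> R.
Proof.
under eq_bigr do under eq_bigr do rewrite invfM.
under eq_bigr do rewrite -big_distrr/=.
apply: (@le_trans _ _ (\sum_(0 <= n < L) 2 * (n.+1%:R ^+ 2)^-1)).
  apply: ler_sum => n _; rewrite -exprVn expr2 mulrCA.
  by rewrite ler_wpM2l ?invr_ge0//; exact: sum_invr_sqr_le.
have -> : 4 = 2 * 2 :> R by rewrite -natrM.
rewrite -big_distrr/= ler_wpM2l//.
have := sum_invr_sqr_le R 0 L; rewrite divr1; apply: le_trans.
by under [leRHS]eq_bigr do rewrite addn0.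
Qed.

Lemma csummable_square (R : realType) (M : R) (u : nat * nat -> R[i]) :
  (forall L, \sum_(0 <= n < L) \sum_(0 <= m < L) `|u (m, n)| <= M%:C) ->
  csummable u.
Proof.
move=> uM; apply: (@csummable_bounded _ _ _ M
   (fun L => [seq (m, n) | n <- index_iota 0 L, m <- index_iota 0 L])).
- move=> L; apply: allpairs_uniq; rewrite ?iota_uniq//.
  by move=> [a b] [c d] _ _ /= [-> ->].
- move=> [m n]; exists (maxn m n).+1 => L; rewrite gtn_max => /andP[mL nL].
  by apply/allpairsP; exists (n, m) => /=; rewrite !mem_index_iota.
- by move=> L; rewrite big_allpairs_dep.
Qed.

Lemma csummable_pair_row (R : realType) (C : R) (u : nat * nat -> R[i]) :
  0 <= C -> (forall m n,
    `|u (m, n)| <= (C / (n.+1%:R * (m + n).+1%:R ^+ 2))%:C) -> csummable u.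
Proof.
move=> C0 uC; apply: (@csummable_square _ (C * 4)) => L.
apply: (@le_trans _ _ (\sum_(0 <= n < L) \sum_(0 <= m < L)
    (C / (n.+1%:R * (m + n).+1%:R ^+ 2))%:C)).
  by apply: ler_sum => n _; apply: ler_sum => m _.
under eq_bigr do rewrite -rmorph_sum -big_distrr/=.
by rewrite -rmorph_sum lecR -big_distrr/= ler_wpM2l// sum_pair_bound.
Qed.

Lemma csummable_pair_col (R : realType) (C : R) (u : nat * nat -> R[i]) :
  0 <= C -> (forall m n,
    `|u (m, n)| <= (C / (m.+1%:R * (m + n).+1%:R ^+ 2))%:C) -> csummable u.
Proof.
move=> C0 uC; apply: (@csummable_square _ (C * 4)) => L.
rewrite exchange_big/=.
apply: (@le_trans _ _ (\sum_(0 <= m < L) \sum_(0 <= n < L)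
    (C / (m.+1%:R * (n + m).+1%:R ^+ 2))%:C)).
  by apply: ler_sum => n _; apply: ler_sum => m _; rewrite addnC.
under eq_bigr do rewrite -rmorph_sum -big_distrr/=.
by rewrite -rmorph_sum lecR -big_distrr/= ler_wpM2l// sum_pair_bound.
Qed.

(** * The cotangent series *)

(* [ctg y = 0] at the poles of the cotangent, as division by zero gives 0; the
   duplication formula holds there as well. *)
Definition ctg (R : realType) (y : R) : R := cos y / sin y.

Lemma ctgDpi (R : realType) (y : R) : ctg (y + pi) = ctg y.
Proof. by rewrite /ctg cosDpi sinDpi invrN mulrNN. Qed.

Lemma ctgDpin (R : realType) (y : R) (n : nat) : ctg (y + n%:R * pi) = ctg y.
Proof.
elim: n => [|n IH]; first by rewrite mul0r addr0.
by rewrite -natr1 mulrDl mul1r addrA ctgDpi.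
Qed.

Lemma ctgN (R : realType) (y : R) : ctg (- y) = - ctg y.
Proof. by rewrite /ctg cosN sinN invrN mulrN. Qed.

Lemma ctg_double (R : realType) (z : R) :
  ctg z + ctg (z + pi / 2) = 2 * ctg (2 * z).
Proof.
rewrite /ctg cosDpihalf sinDpihalf [2 * z]mulr_natl cos_mulr2n sin_mulr2n.
have [->|s0] := eqVneq (sin z) 0.
  by rewrite mulr0 mul0rn oppr0 invr0 !mulr0 mul0r addr0.
have [->|c0] := eqVneq (cos z) 0.
  by rewrite !mul0r mul0rn invr0 !mulr0 addr0.
rewrite cos2sin2; have := cos2Dsin2 z => H.
rewrite -(mulr_natl (cos z * sin z)) -(mulr_natl (1 - sin z ^+ 2)).
have -> : 2 * (1 - sin z ^+ 2) - 1 = cos z ^+ 2 - sin z ^+ 2 by lra.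
by field; rewrite s0.
Qed.

(** When the number of points doubles to [2 ^ m.+1], the arguments of index [k] and [k + 2 ^ m]
    differ by [pi / 2], so [ctg_double] merges them. *)
Lemma sum_ctg (R : realType) (y : R) (m : nat) :
  \sum_(0 <= k < 2 ^ m) ctg ((y + k%:R * pi) / (2 ^ m)%:R)
    = (2 ^ m)%:R * ctg y.
Proof.
elim: m => [|m IH]; first by rewrite expn0 big_nat1 mul0r addr0 divr1 mul1r.
rewrite expnS mul2n -addnn.
rewrite (big_cat_nat (n := 2 ^ m)) ?leq_addr//=.
rewrite [X in _ + X](big_addn 0 _ (2 ^ m)) addnK -big_split/=.
set N := (2 ^ m)%N; have N0 : N%:R != 0 :> R by rewrite pnatr_eq0 expn_eq0.
have N20 : (N + N)%:R != 0 :> R by rewrite pnatr_eq0 addn_eq0 expn_eq0.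
transitivity (\sum_(0 <= k < N) 2 * ctg ((y + k%:R * pi) / N%:R)).
  apply: eq_bigr => k _.
  have -> : (y + (k + N)%:R * pi) / (N + N)%:R =
     (y + k%:R * pi) / (N + N)%:R + pi / 2.
    by rewrite !natrD; field; rewrite -natrD N20.
  rewrite ctg_double; congr (_ * ctg _).
  by rewrite natrD; field; rewrite -natrD N20 N0.
by rewrite -big_distrr/= IH natrD; ring.
Qed.

Lemma le_sin (R : realType) (y : R) : 0 <= y -> sin y <= y.
Proof.
move=> y0; have [c _] : exists2 c, c \in `[0, y]%R &
    sin y - sin 0 = cos c * (y - 0).
  apply: MVT_segment => //.
  by apply: continuous_subspaceT => x; exact: continuous_sin.
by rewrite sin0 !subr0 => ->; rewrite ler_piMl// cos_le1.
Qed.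

(** By the mean value theorem [sin y = y * cos c] with [c] between 0 and [y], and the cosine
    decreases on this interval. *)
Lemma mulr_cos_le_sin (R : realType) (y : R) : 0 <= y <= pi ->
  y * cos y <= sin y.
Proof.
case/andP => y0 ypi.
have [c] : exists2 c, c \in `[0, y]%R & sin y - sin 0 = cos c * (y - 0).
  apply: MVT_segment => //.
  by apply: continuous_subspaceT => x; exact: continuous_sin.
rewrite in_itv/= => /andP[c0 cy]; rewrite sin0 !subr0 => ->.
rewrite mulrC ler_wpM2r// leNgt ltr_cos ?in_itv/= ?y0 ?ypi//; last first.
  by rewrite c0 (le_trans cy).
by rewrite -leNgt.
Qed.

(** The derivative of [y^-1 - ctg y] is [sin y ^- 2 - y ^- 2], which is nonnegative by [le_sin]. *)
Lemma le_invB_ctg (R : realType) (a b : R) : 0 <= a -> a <= b -> b <= pi / 2 ->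
  a^-1 - ctg a <= b^-1 - ctg b.
Proof.
move=> a0 ab bpi.
have pi0 := pi_gt0 R.
have sin_gt0 (x : R) : 0 < x -> x <= pi / 2 -> 0 < sin x.
  by move=> x0 xpi; apply: sin_gt0_pi; rewrite x0/=; lra.
have [b0|b0] := leP b 0.
  by rewrite (_ : a = b) //; lra.
(* At [a = 0] both terms are 0 by convention, and the claim becomes [ctg b <= b^-1], that is,
   [b * cos b <= sin b]. *)
have [a_le0|a_gt0] := leP a 0.
  have -> : a = 0 by lra.
  rewrite /ctg sin0 invr0 mulr0 subrr subr_ge0 ler_pdivrMr ?sin_gt0//.
  rewrite mulrC ler_pdivlMr// mulrC; apply: mulr_cos_le_sin; lra.
have D (x : R) : 0 < x -> x <= pi / 2 ->
    is_derive x 1 (fun y => y^-1 - ctg y) (- x ^- 2 + sin x ^- 2).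
  move=> x0 xpi; have s0 := sin_gt0 _ x0 xpi.
  have xn0 := lt0r_neq0 x0; have sn0 := lt0r_neq0 s0.
  have D1 : is_derive x 1 (fun y : R => y^-1) (- x ^- 2).
    apply: DeriveDef; first exact: derivableV.
    by rewrite deriveV// derive_id [LHS]mulr1.
  have D2 : is_derive x 1 (fun y : R => (sin y)^-1) (- (sin x) ^- 2 * cos x).
    apply: DeriveDef; first by apply: derivableV => //; exact: derivable_sin.
    by rewrite deriveV// ?derive_val//; exact: derivable_sin.
  have D3 := is_deriveB D1 (is_deriveM (is_derive_cos x) D2).
  apply: (is_derive_eq D3); rewrite /GRing.scale/=.
  have := cos2Dsin2 x => H.
  have -> : cos x * (- sin x ^- 2 * cos x) + (sin x)^-1 * - sin x =
    - (cos x ^+ 2 + sin x ^+ 2) / sin x ^+ 2 by field.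
  by rewrite H mulN1r opprK.
have [c] : exists2 c, c \in `[a, b]%R &
    (b^-1 - ctg b) - (a^-1 - ctg a) = (- c ^- 2 + sin c ^- 2) * (b - a).
  apply: (@MVT_segment _ (fun y => y^-1 - ctg y)
    (fun x => - x ^- 2 + sin x ^- 2)) => //.
    by move=> x; rewrite in_itv/= => /andP[ax xb]; apply: D; lra.
  apply: derivable_within_continuous => x.
  rewrite in_itv/= => /andP[ax xb].
  have x0 : 0 < x by lra.
  have xpi : x <= pi / 2 by lra.
  by case: (D x x0 xpi).
rewrite in_itv/= => /andP[ac cb] E; rewrite -subr_ge0 E mulr_ge0 ?subr_ge0//.
have c0 : 0 < c by lra.
have s0 : 0 < sin c by apply: sin_gt0; lra.
rewrite addrC subr_ge0 ler_pV2 ?inE ?unitfE ?expf_neq0 ?exprn_gt0 ?lt0r_neq0//.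
by rewrite ler_sqr ?nnegrE; [exact/le_sin/ltW|exact: ltW..].
Qed.

(** In [sum_ctg] at [y = pi * s], the second half of the points is read backwards: the point of
    index [2 ^ m.+1 - 1 - k] is [pi - (1 - s + k%:R) * h], where the cotangent is the negative of
    its value at [(1 - s + k%:R) * h]. *)
Lemma sum_ctg_pairs (R : realType) (s : R) (m : nat) :
  let h := pi / (2 ^ m.+1)%:R in
  \sum_(0 <= k < 2 ^ m)
     (ctg ((s + k%:R) * h) - ctg ((1 - s + k%:R) * h))
    = (2 ^ m.+1)%:R * ctg (pi * s).
Proof.
move=> h; rewrite -sum_ctg expnS mul2n -addnn.
have N0 : (2 ^ m.+1)%:R != 0 :> R by rewrite pnatr_eq0 expn_eq0.
rewrite [RHS](big_cat_nat (n := 2 ^ m)) ?leq_addr//=.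
rewrite [X in _ = _ + X](big_addn 0 _ (2 ^ m)) addnK.
rewrite [X in _ = _ + X]big_nat_rev/= -big_split/= add0n.
apply: eq_big_nat => k /andP[_ kN].
rewrite addnn -mul2n -expnS; congr (_ + _).
  by congr ctg; rewrite /h; field.
rewrite -ctgN -[LHS]ctgDpi; congr ctg.
rewrite natrD natrB// -[k.+1%:R]natr1 /h.
have -> : (2 ^ m.+1)%:R = 2 * (2 ^ m)%:R :> R by rewrite expnS natrM.
have N0' : (2 ^ m)%:R != 0 :> R by rewrite pnatr_eq0 expn_eq0.
by field.
Qed.

(** By [sum_ctg_pairs] the error is [h] times a sum of differences of values of
    [g y = y^-1 - ctg y]. This sum is at most [g (pi / 2) = 2 / pi], and [h * (2 / pi)] is the
    inverse of [2 ^ m]. *)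
Lemma ctg_series_bound (R : realType) (s : R) (m : nat) : 0 < s < 1 ->
  `|\sum_(0 <= k < 2 ^ m) ((s + k%:R)^-1 - (1 - s + k%:R)^-1)
     - pi * ctg (pi * s)| <= (2 ^ m)%:R^-1.
Proof.
case/andP => s0 s1; pose h : R := pi / (2 ^ m.+1)%:R.
have N0 : 0 < (2 ^ m.+1)%:R :> R by rewrite ltr0n expn_gt0.
have pi0 := pi_gt0 R.
have h0 : 0 < h by rewrite divr_gt0.
have hn : h != 0 by rewrite gt_eqF.
have -> : pi * ctg (pi * s) = h * ((2 ^ m.+1)%:R * ctg (pi * s)).
  by rewrite mulrA divfK ?gt_eqF.
rewrite -sum_ctg_pairs -/h.
pose g (y : R) := y^-1 - ctg y.
have -> : \sum_(0 <= k < 2 ^ m) ((s + k%:R)^-1 - (1 - s + k%:R)^-1) -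
    h * (\sum_(0 <= k < 2 ^ m)
     (ctg ((s + k%:R) * h) - ctg ((1 - s + k%:R) * h))) =
   h * \sum_(0 <= k < 2 ^ m) (g ((s + k%:R) * h) - g ((1 - s + k%:R) * h)).
  rewrite [h * _]big_distrr [RHS]big_distrr/= -sumrB; apply: eq_bigr => k _.
  have k0 : 0 <= k%:R :> R by [].
  rewrite /g; field.
  by rewrite hn/=; apply/andP; split; apply/eqP; lra.
have gpi : h * g (pi / 2) = (2 ^ m)%:R^-1.
  rewrite /g /ctg cos_pihalf mul0r subr0 /h expnS natrM.
  move: (@pi R) (lt0r_neq0 pi0) => p p0; field.
  by rewrite p0 pnatr_eq0 expn_eq0.
rewrite normrM (gtr0_norm h0) -gpi ler_wpM2l ?(ltW h0)//.
have hN : (2 ^ m)%:R * h = pi / 2.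
  by rewrite /h expnS natrM; field; rewrite pnatr_eq0 expn_eq0.
have g0 : g 0 = 0 by rewrite /g /ctg sin0 invr0 mulr0 subr0.
(* Both arguments of the term of index [k] lie between [k%:R * h] and [(k%:R + 1) * h]; as [g] is
   monotone, the term is bounded by the increment of [g] there, and these increments telescope. *)
suff H (n : nat) : (n <= 2 ^ m)%N ->
    `|\sum_(0 <= k < n) (g ((s + k%:R) * h) - g ((1 - s + k%:R) * h))|
      <= g (n%:R * h).
  by rewrite -hN; exact: H.
elim: n => [|n IH] nN; first by rewrite big_nil normr0 mul0r g0.
rewrite big_nat_recr//= (le_trans (ler_normD _ _))//.
have n0 : 0 <= n%:R :> R by [].
have nh : (n%:R + 1) * h <= pi / 2.
  by rewrite -hN natr1 ler_wpM2r ?(ltW h0)// ler_nat.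
have mono (a b : R) : 0 <= a -> a <= b -> b <= n%:R + 1 ->
    g (a * h) <= g (b * h).
  move=> a0 ab bn; apply: le_invB_ctg.
  - by rewrite mulr_ge0// ltW.
  - by rewrite ler_wpM2r// ltW.
  - by apply: le_trans nh; rewrite ler_wpM2r// ltW.
have := IH (ltnW nN).
have h1 : g (n%:R * h) <= g ((s + n%:R) * h) by apply: mono; lra.
have h2 : g (n%:R * h) <= g ((1 - s + n%:R) * h) by apply: mono; lra.
have h3 : g ((s + n%:R) * h) <= g ((n%:R + 1) * h) by apply: mono; lra.
have h4 : g ((1 - s + n%:R) * h) <= g ((n%:R + 1) * h) by apply: mono; lra.
move=> h5; rewrite -natr1.
suff : `|g ((s + n%:R) * h) - g ((1 - s + n%:R) * h)| <=
   g ((n%:R + 1) * h) - g (n%:R * h) by move: h5; lra.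
rewrite ler_norml; apply/andP; split; lra.
Qed.

(** * Residue classes *)

(** With [0^-1 = 0] this also holds where [sin (2 * z)] vanishes, so that [cvg_row] can apply it
    even if [N] divides [2 * j + 1]. *)
Lemma ctgB_double (R : realType) (z : R) :
  ctg z - ctg (2 * z) = (sin (2 * z))^-1.
Proof.
rewrite /ctg [2 * z]mulr_natl cos_mulr2n sin_mulr2n.
have [->|s0] := eqVneq (sin z) 0.
  by rewrite mulr0 mul0rn invr0 !mulr0 subrr.
have [->|c0] := eqVneq (cos z) 0.
  by rewrite !mul0r mul0rn invr0 !mulr0 subrr.
rewrite -(mulr_natl (cos z * sin z)) -(mulr_natl (cos z ^+ 2)).
by field; rewrite s0.
Qed.

Lemma big_nat_class (V : nmodType) (F : nat -> V) (N r T : nat) : (r < N)%N ->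
  \sum_(0 <= m < N * T) (if (m %% N == r)%N then F m else 0)
    = \sum_(0 <= t < T) F (r + N * t)%N.
Proof.
move=> rN; rewrite mulnC big_nat_mul; apply: eq_bigr => t _.
rewrite -{1}[(t * N)%N]add0n big_addn mulSn addnK big_mkord.
rewrite (bigD1 (Ordinal rN))//= addnC modnMDl modn_small// eqxx big1.
  by rewrite addr0 addnC [(t * N)%N]mulnC.
move=> i ir; rewrite addnC modnMDl modn_small//.
by case: eqP => // iE; case/eqP: ir; exact: val_inj.
Qed.

(** The sum telescopes to its first [c] values minus [c] values of [F] far out, a fixed number of
    terms that each tend to 0. *)
Lemma cvg_sum_shift (R : realType) (F : nat -> R) (c : nat)
    (phi : nat -> nat) : F @ \oo --> 0 -> phi @ \oo --> \oo ->
  \sum_(0 <= m < phi i) (F m - F (m + c)%N) @[i --> \oo]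
    --> \sum_(0 <= m < c) F m.
Proof.
move=> F0 phioo.
have E M : \sum_(0 <= m < M) (F m - F (m + c)%N) =
    \sum_(0 <= m < c) F m - \sum_(0 <= m < c) F (m + M)%N.
  apply/eqP; rewrite sumrB subr_eq addrAC eq_sym subr_eq; apply/eqP.
  have := @big_cat_nat _ 0 +%R c 0 (M + c) predT F (leq0n _) (leq_addl _ _).
  have := @big_cat_nat _ 0 +%R M 0 (M + c) predT F (leq0n _) (leq_addr _ _).
  rewrite [X in _ = _ + X -> _](big_addn 0 _ M) addKn => ->.
  by rewrite [X in _ = _ + X -> _](big_addn 0 _ c) addnK.
under eq_fun do rewrite E.
have tail0 : \sum_(0 <= m < c) F (m + phi i)%N @[i --> \oo] --> (0 : R).
  elim: c {E} => [|c IH].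
    by apply: cvg_near_cst; near=> i; rewrite big_nil.
  under eq_fun do rewrite (big_nat_recr _ _ _ (leq0n c))/=.
  have phic : (fun i => (c + phi i)%N) @ \oo --> \oo.
    exact: (cvg_comp _ (addn c) phioo (@cvg_addnl c)).
  have := cvgD IH (cvg_comp _ F phic F0); rewrite addr0; exact.
have := cvgB (cvg_cst (\sum_(0 <= m < c) F m)) tail0; rewrite subr0; exact.
Unshelve. all: by end_near. Qed.

Lemma cvg_muln_expn (N : nat) : (0 < N)%N ->
  (fun i => (N * 2 ^ i)%N) @ \oo --> \oo.
Proof.
move=> N0; apply/cvgnyPge => A; near=> i.
have Ai : (A <= i)%N by near: i; exact: nbhs_infty_ge.
rewrite (leq_trans Ai)// (leq_trans (ltnW (ltn_expl i (ltnSn 1))))//.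
exact: leq_pmull.
Unshelve. all: by end_near. Qed.

Lemma cvg_invn_shift (R : realType) (c : R) (b : nat -> bool) : 0 < c ->
  (if b m then (m%:R + c)^-1 else 0) @[m --> \oo] --> (0 : R).
Proof.
move=> c0; apply/cvgrPdist_le => e e0; near=> m.
have m0 : 0 < m%:R + c by rewrite ltr_wpDl.
have em : e^-1 <= m%:R by near: m; exact: nbhs_infty_ger.
rewrite sub0r normrN; case: ifP => _; last by rewrite normr0 ltW.
rewrite gtr0_norm ?invr_gt0// -[leRHS]invrK ler_pV2 ?inE ?unitfE.
- by rewrite (le_trans em)// lerDl ltW.
- by rewrite m0 gt_eqF.
- by rewrite invr_gt0 e0 gt_eqF ?invr_gt0.
Unshelve. all: by end_near. Qed.

(** For [m = r + N * t] the denominator is [N%:R * (s + t%:R)], and for [m = r' + N * t] it is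
    [N%:R * (1 - s + t%:R)]. The length [N * 2 ^ i] takes exactly [2 ^ i] members of each class, as
    [ctg_series_bound] requires. *)
Lemma cvg_class_ctg (R : realType) (N r r' : nat) (c s : R) :
  (r < N)%N -> (r' < N)%N -> 0 < s < 1 -> r%:R + c = N%:R * s ->
  r'%:R + c = N%:R * (1 - s) ->
  \sum_(0 <= m < N * 2 ^ i)
     ((if (m %% N == r)%N then (m%:R + c)^-1 else 0)
       - (if (m %% N == r')%N then (m%:R + c)^-1 else 0)) @[i --> \oo]
    --> pi / N%:R * ctg (pi * s).
Proof.
move=> rN r'N s01 rE r'E.
have N0 : 0 < N%:R :> R by rewrite ltr0n (leq_ltn_trans _ rN).
have -> : pi / N%:R * ctg (pi * s) = N%:R^-1 * (pi * ctg (pi * s)).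
  by rewrite [RHS]mulrCA [RHS]mulrA.
rewrite (_ : (fun i => _) = (fun i => N%:R^-1 *
   \sum_(0 <= k < 2 ^ i) ((s + k%:R)^-1 - (1 - s + k%:R)^-1))); last first.
  apply/funext => i; rewrite sumrB !big_nat_class// -sumrB big_distrr/=.
  apply: eq_bigr => k _.
  rewrite ![(_ + N * k)%:R]natrD natrM addrAC rE addrAC r'E -!mulrDr !invfM.
  by rewrite mulrBr.
apply: cvgMr; apply/cvgrPdist_le => e e0; near=> i.
rewrite distrC (le_trans (ctg_series_bound i s01))//.
have ei : e^-1 <= i%:R by near: i; exact: nbhs_infty_ger.
rewrite -[leRHS]invrK ler_pV2 ?inE ?unitfE.
- by rewrite (le_trans ei)// ler_nat ltnW// ltn_expl.
- by rewrite ltr0n expn_gt0 pnatr_eq0 expn_eq0.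
- by rewrite invr_gt0 e0 gt_eqF ?invr_gt0.
Unshelve. all: by end_near. Qed.

Lemma mod_diagE (N m n : nat) : mod_diag N m n = (m %% N == n %% N)%N.
Proof. by rewrite /mod_diag !modz_nat eqz_nat. Qed.

Lemma mod_antiE (N m n : nat) : mod_anti N m n = (N %| m + (2 * n + 1).+1)%N.
Proof.
rewrite /mod_anti eqz_mod_dvd -[RHS]/((N%:Z %| (m + (2 * n + 1).+1)%N%:Z)%Z).
by congr (_ \in dvdz _); lia.
Qed.

(** The two residues plus 1 add up to a number strictly between 0 and [2 * N], whose only multiple
    of [N] there is [N] itself. *)
Lemma dvdn_addS_class (N f c : nat) : (0 < N)%N ->
  (N %| f + c.+1)%N = (f %% N == N.-1 - c %% N)%N.
Proof.
move=> N0; have fN := ltn_pmod f N0; have cN := ltn_pmod c N0.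
have -> : (N %| f + c.+1)%N = (N %| f %% N + (c %% N).+1)%N.
  rewrite {1}(divn_eq f N) {1}(divn_eq c N) -addnS addnACA -mulnDl.
  by rewrite dvdn_addr// dvdn_mull.
apply/idP/eqP => [/dvdnP[[|[|q]] qE]|->]; [lia|lia| |].
  by exfalso; move: qE; rewrite !mulSn; lia.
by rewrite (_ : _ + _ = N)%N//; lia.
Qed.

Lemma ctg_mod (R : realType) (N p : nat) : (0 < N)%N ->
  ctg (pi * ((p %% N)%:R / N%:R)) = ctg (pi * (p%:R / N%:R)) :> R.
Proof.
move=> N0; rewrite -(ctgDpin _ (p %/ N)); congr ctg.
have N1 : N%:R != 0 :> R by rewrite pnatr_eq0 -lt0n.
by rewrite [in RHS](divn_eq p N) natrD natrM; field.
Qed.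

(** * The series over [m] for a fixed row [j] *)

Section Row.
Variables (R : realType) (N j : nat).
Hypothesis hN : odd N.

Let N0 : (0 < N)%N. Proof. by case: N hN. Qed.

Let natrN1 : N.-1%:R = N%:R - 1 :> R.
Proof. by rewrite -[in RHS](prednK N0) -natr1 addrK. Qed.

(* The terms subtracted in [row_term m] below are [int_tail (m + j)] and
   [half_tail (m + j.+1)], supported on fixed residue classes mod [N]. *)
Definition half_tail (m : nat) : R :=
  if (N %| m + j.+1)%N then (m%:R + 1 / 2)^-1 else 0.

Definition int_tail (m : nat) : R :=
  if (m %% N == (2 * j) %% N)%N then (m%:R + 1)^-1 else 0.

(** What the first four families contribute to the coefficient of [x ^+ j] at a given [m], up to the
    factor [((j%:R + 1 / 2) ^+ (k + 1))^-1]; see [sum_first_terms]. *)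
Definition row_term (m : nat) : R :=
  (if mod_diag N m j then (m%:R + 1 / 2)^-1 - (m + j + 1)%:R^-1 else 0)
  + (if mod_anti N m j then (m + 1)%:R^-1 - ((m + j)%:R + 3 / 2)^-1 else 0).

(** The tails are added and subtracted so that each group has a known limit: the first two compare
    opposite residue classes as in [cvg_class_ctg], the last two telescope as in [cvg_sum_shift]. *)
Lemma row_termE m : row_term m =
   ((if (m %% N == j %% N)%N then (m%:R + 1 / 2)^-1 else 0) - half_tail m)
   - (int_tail m - (if (N %| m + (2 * j + 1).+1)%N then (m%:R + 1)^-1 else 0))
   + (half_tail m - half_tail (m + j.+1)) + (int_tail m - int_tail (m + j)).
Proof.
have H1 : half_tail (m + j.+1) =
    if (N %| m + (2 * j + 1).+1)%N then ((m + j)%:R + 3 / 2)^-1 else 0.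
  rewrite /half_tail (_ : _ + j.+1 + j.+1 = m + (2 * j + 1).+1)%N; last by lia.
  congr (if _ then _^-1 else 0).
  by rewrite addnS -[(m + j).+1%:R]natr1 -addrA; congr (_ + _); field.
have H2 : int_tail (m + j) =
    if (m %% N == j %% N)%N then (m + j + 1)%:R^-1 else 0.
  by rewrite /int_tail natr1 addn1 mul2n -addnn eqn_modDr.
rewrite H1 H2 /row_term mod_diagE mod_antiE /int_tail /half_tail.
rewrite [(m + 1)%:R]natrD.
by case: ifP => _; case: ifP => _; case: ifP => _; case: ifP => _; ring.
Qed.

Lemma cvg_row_half : \sum_(0 <= m < N * 2 ^ i)
    ((if (m %% N == j %% N)%N then (m%:R + 1 / 2)^-1 else 0) - half_tail m)
    @[i --> \oo] --> pi / N%:R * ctg (pi * ((2 * j + 1)%:R / N%:R / 2) : R).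
Proof.
have N1 : 0 < N%:R :> R by rewrite ltr0n.
have jN := ltn_pmod j N0.
have jN1 : (j %% N)%:R + 1 <= N%:R :> R by rewrite natr1 ler_nat.
have j0 : 0 <= (j %% N)%:R :> R by [].
(* The parameter must lie between 0 and 1, hence the residue of [j]; periodicity of the cotangent
   then restores [j]. *)
have := @cvg_class_ctg R N (j %% N) (N.-1 - j %% N) (1 / 2)
  (((j %% N)%:R + 1 / 2) / N%:R) jN.
have -> : ctg (pi * (((j %% N)%:R + 1 / 2) / N%:R)) =
    ctg (pi * ((2 * j + 1)%:R / N%:R / 2)) :> R.
  rewrite -(ctgDpin _ (j %/ N)); congr ctg.
  have N2 := lt0r_neq0 N1.
  by rewrite [in RHS](divn_eq j N) !(natrD, natrM); field.
under [in X in _ -> X]eq_fun do under eq_bigr do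
  rewrite /half_tail dvdn_addS_class//.
apply.
- by rewrite (leq_ltn_trans (leq_subr _ _))// prednK.
- rewrite divr_gt0 ?ltr_wpDl//= ltr_pdivrMr// mul1r; lra.
- by rewrite [RHS]mulrC divfK// gt_eqF.
- rewrite mulrBr mulr1 [N%:R * _]mulrC divfK ?gt_eqF//.
  rewrite natrB; last by rewrite -ltnS prednK.
  by rewrite natrN1; field.
Qed.

Lemma cvg_row_int : \sum_(0 <= m < N * 2 ^ i)
    (int_tail m - (if (N %| m + (2 * j + 1).+1)%N then (m%:R + 1)^-1 else 0))
    @[i --> \oo] --> pi / N%:R * ctg (pi * ((2 * j + 1)%:R / N%:R) : R).
Proof.
have N1 : 0 < N%:R :> R by rewrite ltr0n.
rewrite -ctg_mod//; set p := (2 * j + 1)%N.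
(* If [N] divides [2 * j + 1], the two residue classes coincide and every term is 0, in agreement
   with [ctg 0 = 0]. *)
have [Np|Np] := boolP (N %| p)%N.
  rewrite (eqP Np) mul0r mulr0 [ctg 0]/ctg sin0 invr0 !mulr0.
  apply: cvg_near_cst; near=> i; rewrite big1// => m _.
  rewrite /int_tail dvdn_addS_class// (eqP Np) subn0.
  have := Np; rewrite /p dvdn_addS_class// mod0n subn0 => /eqP ->.
  by rewrite subrr.
have pE : (p %% N = ((2 * j) %% N).+1)%N.
  by move: Np; rewrite /p addn1 modnS; case: ifP.
have pN : (p %% N < N)%N by rewrite ltn_pmod.
have := @cvg_class_ctg R N ((2 * j) %% N) (N.-1 - p %% N) 1
  ((p %% N)%:R / N%:R).
under [in X in _ -> X]eq_fun do under eq_bigr do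
  rewrite /int_tail dvdn_addS_class//.
apply.
- by rewrite ltn_pmod.
- by rewrite (leq_ltn_trans (leq_subr _ _))// prednK.
- by rewrite divr_gt0 ?ltr0n ?pE//= ltr_pdivrMr// mul1r ltr_nat -pE.
- by rewrite [RHS]mulrC divfK ?gt_eqF// pE natr1.
- rewrite mulrBr mulr1 [N%:R * _]mulrC divfK ?gt_eqF//.
  rewrite natrB; last by rewrite -ltnS prednK.
  by rewrite natrN1; ring.
Unshelve. all: by end_near. Qed.

Lemma cvg_row : \sum_(0 <= m < N * 2 ^ i) row_term m @[i --> \oo] -->
  pi / N%:R / sin ((2 * j + 1)%:R * pi / N%:R)
  + (if (N %| 2 * j + 1)%N then (j%:R + 1 / 2)^-1 else 0)
  + \sum_(0 <= m < j) (half_tail m + int_tail m).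
Proof.
have Noo := cvg_muln_expn N0.
have half0 : half_tail @ \oo --> (0 : R) by apply: cvg_invn_shift.
have int0 : int_tail @ \oo --> (0 : R) by apply: cvg_invn_shift.
have := cvgD (cvgD (cvgB cvg_row_half cvg_row_int)
  (cvg_sum_shift (c := j.+1) half0 Noo)) (cvg_sum_shift (c := j) int0 Noo).
rewrite -mulrBr.
have -> : pi * ((2 * j + 1)%:R / N%:R) =
    2 * (pi * ((2 * j + 1)%:R / N%:R / 2)) :> R.
  by field; rewrite pnatr_eq0 -lt0n.
rewrite ctgB_double.
have -> : 2 * (pi * ((2 * j + 1)%:R / N%:R / 2)) =
    (2 * j + 1)%:R * pi / N%:R :> R.
  by field; rewrite pnatr_eq0 -lt0n.
(* The shift of [half_tail] is [j.+1] but that of [int_tail] is [j]; the extra value [half_tail j]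
   is the isolated term present when [N] divides [2 * j + 1]. *)
rewrite (big_nat_recr _ _ _ (leq0n j))/= [half_tail j]/half_tail.
have -> : (N %| j + j.+1)%N = (N %| 2 * j + 1)%N by congr (_ %| _)%N; lia.
set A := _ / _ / _; set B := \sum_(0 <= _ < j) half_tail _.
set C := if _ then _ else _; set D := \sum_(0 <= _ < j) int_tail _.
rewrite big_split/= -/B -/D.
have -> : A + (B + C) + D = A + C + (B + D) by ring.
have E (i : nat) : \sum_(0 <= m < N * 2 ^ i) row_term m =
    \sum_(0 <= m < N * 2 ^ i)
      ((if (m %% N == j %% N)%N then (m%:R + 1 / 2)^-1 else 0) - half_tail m)
    - \sum_(0 <= m < N * 2 ^ i) (int_tail m -
        (if (N %| m + (2 * j + 1).+1)%N then (m%:R + 1)^-1 else 0))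
    + \sum_(0 <= m < N * 2 ^ i) (half_tail m - half_tail (m + j.+1))
    + \sum_(0 <= m < N * 2 ^ i) (int_tail m - int_tail (m + j)).
  by rewrite -sumrB -!big_split/=; apply: eq_bigr => m _; rewrite row_termE.
by move=> H; rewrite (funext E); exact: H.
Qed.
End Row.

(** * Summability of the terms *)

Lemma half_pow_ge (R : realFieldType) (a y : R) (i j : nat) :
  1 <= a -> a / 2 <= y -> (i <= j)%N -> a ^+ i / 2 ^+ j <= y ^+ j.
Proof.
move=> a1 ay ij; have a0 : 0 <= a by lra.
apply: (@le_trans _ _ ((a / 2) ^+ j)); last by rewrite lerXn2r ?nnegrE; lra.
by rewrite expr_div_n ler_wpM2r ?invr_ge0 ?exprn_ge0// ler_weXn2l.
Qed.

Lemma norm_div_real_le (R : realType) (x : R[i]) (e : nat) (b d : R) :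
  `|x| <= 1 -> 0 < b -> b <= d -> `|x ^+ e / d%:C| <= (b^-1)%:C.
Proof.
move=> x1 b0 bd; have d0 : 0 < d by rewrite (lt_le_trans b0).
rewrite normrM normfV normrX norm_real_complex (gtr0_norm d0) -fmorphV.
rewrite -[leRHS]mul1r ler_pM ?exprn_ge0 ?exprn_ile1//.
  by rewrite lecR invr_ge0 ltW.
by rewrite lecR lef_pV2.
Qed.

(** The exponents are lowered to 1 and 2, the shape required by [csummable_pair_row] and
    [csummable_pair_col]; the factor [2 ^+ i] pays for [a / 2 <= y]. *)
Lemma norm_term_le (R : realType) (x : R[i]) (e i j m n : nat) (a y z : R) :
  `|x| <= 1 -> 1 <= a -> a / 2 <= y -> (m + n).+1%:R <= z ->
  (0 < i)%N -> (1 < j)%N ->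
  `|x ^+ e / (y ^+ i * z ^+ j)%:C|
    <= (2 ^+ i / (a * (m + n).+1%:R ^+ 2))%:C.
Proof.
move=> x1 a1 ay bz i0 j1; have b1 : 1 <= (m + n).+1%:R :> R by rewrite ler1n.
have a0 : 0 < a by lra.
have -> : 2 ^+ i / (a * (m + n).+1%:R ^+ 2) =
   (a / 2 ^+ i * (m + n).+1%:R ^+ 2)^-1 :> R.
  by rewrite !invfM invrK mulrCA mulrA.
apply: norm_div_real_le => //.
  by rewrite mulr_gt0 ?divr_gt0 ?exprn_gt0// (lt_le_trans _ b1).
apply: ler_pM => //; first by rewrite divr_ge0 ?exprn_ge0// ltW.
  by rewrite -{1}[a]expr1 half_pow_ge.
apply: (@le_trans _ _ ((m + n).+1%:R ^+ j)); first by rewrite ler_weXn2l.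
by rewrite lerXn2r ?nnegrE//; lra.
Qed.

Lemma eq_restr2 (R : realType) (P : nat -> nat -> bool)
    (F G : nat -> nat -> R[i]) :
  (forall m n, F m n = G m n) -> restr2 P F = restr2 P G.
Proof. by move=> FG; apply/funext => -[m n]; rewrite /restr2 FG. Qed.

Section Terms.
Variables (R : realType) (x : R[i]) (P : nat -> nat -> bool).
Variables (e : nat -> nat -> nat) (y z : nat -> nat -> R) (i j : nat).
Hypothesis x1 : `|x| <= 1.
Hypothesis i0 : (0 < i)%N.
Hypothesis j1 : (1 < j)%N.
Hypothesis hz : forall m n, (m + n).+1%:R <= z m n.

Let F m n := x ^+ e m n / (y m n ^+ i * z m n ^+ j)%:C.

(** For the families whose first factor is a power of [n + 1 / 2]. *)
Lemma csummable_term_row :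
  (forall m n, n.+1%:R / 2 <= y m n) -> csummable (restr2 P F).
Proof.
move=> hy; apply: (@csummable_pair_row _ (2 ^+ i)).
  by rewrite exprn_ge0.
move=> m n; rewrite /restr2/=; case: ifP => _.
  by apply: norm_term_le; rewrite ?ler1n.
by rewrite normr0 lecR divr_ge0 ?exprn_ge0// mulr_ge0.
Qed.

(** For the families whose first factor is [m + 1 / 2] or [m + 1]. *)
Lemma csummable_term_col :
  (forall m n, m.+1%:R / 2 <= y m n) -> csummable (restr2 P F).
Proof.
move=> hy; apply: (@csummable_pair_col _ (2 ^+ i)).
  by rewrite exprn_ge0.
move=> m n; rewrite /restr2/=; case: ifP => _.
  by apply: norm_term_le; rewrite ?ler1n.
by rewrite normr0 lecR divr_ge0 ?exprn_ge0// mulr_ge0.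
Qed.
End Terms.

(** Raising [k] by one divides every old term by [b + a] and adds the single term
    [(a ^+ k.+1 * (b + a) ^+ 2)^-1]. *)
Lemma sum_partial_fractions (F : fieldType) (a b : F) (k : nat) :
  a != 0 -> b != 0 -> b + a != 0 ->
  \sum_(1 <= nu < k.+1) (a ^+ nu * (b + a) ^+ (k + 2 - nu))^-1
    + (b * (b + a) ^+ (k + 1))^-1
  = (a ^+ (k + 1))^-1 * (b^-1 - (b + a)^-1).
Proof.
move=> a0 b0 ba0; elim: k => [|k IH].
  by rewrite big_geq// add0r !add0n !expr1; field; rewrite a0 b0 ba0.
rewrite big_nat_recr//=.
have -> : (k.+1 + 2 - k.+1 = 2)%N by lia.
under eq_big_nat => nu /andP[_ nuk].
  rewrite (_ : k.+1 + 2 - nu = (k + 2 - nu).+1)%N; last by lia.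
  rewrite exprSr mulrA invfM.
  over.
have -> : (b * (b + a) ^+ (k.+1 + 1))^-1 =
    (b * (b + a) ^+ (k + 1))^-1 / (b + a).
  by rewrite addSn exprSr mulrA invfM.
rewrite -big_distrl/= addrAC -mulrDl IH addSn !addn1 [a ^+ k.+2]exprS.
by field; rewrite a0 b0 ba0 expf_neq0.
Qed.

Lemma sin_nat_pi (R : realType) (n : nat) : sin (n%:R * pi) = 0 :> R.
Proof.
elim: n => [|n IH]; first by rewrite mul0r sin0.
by rewrite -natr1 mulrDl mul1r sinDpi IH oppr0.
Qed.

Lemma norm_sin_mod (R : realType) (N p : nat) : (0 < N)%N ->
  `|sin (p%:R * pi / N%:R)| = `|sin ((p %% N)%:R * pi / N%:R)| :> R.
Proof.
move=> N0; have N1 : N%:R != 0 :> R by rewrite pnatr_eq0 -lt0n.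
have H (q : nat) (t : R) : `|sin (t + q%:R * pi)| = `|sin t|.
  elim: q => [|q IH]; first by rewrite mul0r addr0.
  by rewrite -natr1 mulrDl mul1r addrA sinDpi normrN.
rewrite -[RHS](H (p %/ N)%N); congr `|sin _|.
by rewrite {1}(divn_eq p N) natrD natrM; field.
Qed.

Lemma csummable_sin (R : realType) (x : R[i]) (N k : nat) (P : nat -> bool) :
  (0 < N)%N -> (0 < k)%N -> `|x| <= 1 ->
  csummable (restr1 P (fun m => x ^+ m
     / ((sin ((2 * m + 1)%:R * pi / N%:R : R))%:C
        * (m%:R + 1 / 2) ^+ (k + 1)))).
Proof.
move=> N0 k0 x1.
(* The modulus of the sine depends only on [2 * m + 1] mod [N], so [S] bounds all its inverses; a
   vanishing sine contributes 0. *)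
pose S : R := \sum_(r < N) `|sin (r%:R * pi / N%:R)|^-1.
have S0 : 0 <= S by apply: sumr_ge0 => r _; rewrite invr_ge0.
apply: (@csummable_nat _ (S * 2 ^+ (k + 1))) => [|m].
  by rewrite mulr_ge0 ?exprn_ge0.
rewrite /restr1; case: ifP => _; last first.
  by rewrite normr0 lecR divr_ge0 ?exprn_ge0// mulr_ge0 ?exprn_ge0.
set s : R := sin _; set d := (_ + _) ^+ _.
have -> : x ^+ m / (s%:C * d) = (s^-1)%:C * (x ^+ m / d).
  by rewrite invfM mulrCA fmorphV.
have -> : (S * 2 ^+ (k + 1) / m.+1%:R ^+ 2)%:C =
    S%:C * (2 ^+ (k + 1) / m.+1%:R ^+ 2)%:C :> R[i] by rewrite -mulrA rmorphM.
rewrite normrM norm_real_complex; apply: ler_pM => //; first by rewrite lecR.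
  rewrite lecR normfV norm_sin_mod// /S.
  rewrite (bigD1 (Ordinal (ltn_pmod (2 * m + 1) N0)))//=.
  by rewrite lerDl sumr_ge0// => r _; rewrite invr_ge0.
rewrite /d.
rewrite (_ : (m%:R + 1 / 2) ^+ (k + 1) =
   (((m%:R + 1 / 2) ^+ (k + 1) : R)%:C)); last first.
  by rewrite !(rmorphXn, rmorphD, rmorphM, fmorphV, rmorph1, rmorph_nat).
rewrite -[2 ^+ _ / _]invf_div; apply: norm_div_real_le => //.
apply: half_pow_ge; [by rewrite ler1n| |lia].
by rewrite -[m.+1%:R]natr1; have := ler0n R m; lra.
Qed.

Lemma csummable_half_pow (R : realType) (x : R[i]) (N k : nat) :
  `|x| <= 1 ->
  csummable (fun n => x ^+ (N * n) / (n%:R + 1 / 2) ^+ (k + 2)).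
Proof.
move=> x1; apply: (@csummable_nat _ (2 ^+ (k + 2))) => [|n].
  by rewrite exprn_ge0.
rewrite (_ : (n%:R + 1 / 2) ^+ (k + 2) =
   (((n%:R + 1 / 2) ^+ (k + 2) : R)%:C)); last first.
  by rewrite !(rmorphXn, rmorphD, rmorphM, fmorphV, rmorph1, rmorph_nat).
rewrite -[2 ^+ _ / _]invf_div; apply: norm_div_real_le => //.
apply: half_pow_ge; [by rewrite ler1n| |lia].
by rewrite -[n.+1%:R]natr1; have := ler0n R n; lra.
Qed.

(** With [N = 2 * h + 1] one has [2 * (j + h.+1) = 2 * j + 1 + N], and 2 is coprime to [N]; so the
    condition is [N %| j + h.+1], that is, [j] is congruent to [h]. *)
Lemma dvdn_double_class (N j : nat) : odd N ->
  (N %| 2 * j + 1)%N = (j %% N == (N - 1) %/ 2)%N.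
Proof.
move=> oN; have [h hE] : exists h, N = (2 * h + 1)%N.
  by exists N./2; rewrite -{1}(odd_double_half N) oN -muln2; lia.
have -> : (N %| 2 * j + 1)%N = (N %| j + h.+1)%N.
  rewrite -[RHS](@Gauss_dvdr N 2); last by rewrite coprimen2.
  rewrite (_ : 2 * (j + h.+1) = 2 * j + 1 + N)%N; last by lia.
  by rewrite [RHS]dvdn_addl.
rewrite dvdn_addS_class; last by lia.
rewrite (_ : (N - 1) %/ 2 = h)%N; last by rewrite hE addnK mulKn.
by rewrite [(h %% N)%N]modn_small; [congr (_ == _); lia|lia].
Qed.

(** * Coefficients *)

(* The quotient by the sine is [0] when [N] divides [2 * j + 1], as division by
   zero gives [0]. *)
Definition row_coef (R : realType) (N k j : nat) : R :=
  ((j%:R + 1 / 2) ^+ (k + 1))^-1 *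
  (pi / N%:R / sin ((2 * j + 1)%:R * pi / N%:R)
   + (if (N %| 2 * j + 1)%N then (j%:R + 1 / 2)^-1 else 0)).

(** The finite part of the row limit; by [sum_last_terms] it is the coefficient of [x ^+ j] in the
    last two families, which cancel it. *)
Definition row_diag (R : realType) (N k j : nat) : R :=
  ((j%:R + 1 / 2) ^+ (k + 1))^-1 *
  \sum_(0 <= m < j) (half_tail R N j m + int_tail R N j m).

(** Pairs are grouped by [j = m + n + 1], the exponent of [x] in the last two families; the group
    [j = 0] is empty. *)
Lemma cvg_triangle (R : realType) (u : nat * nat -> R[i]) l :
  has_csum u l ->
  (\sum_(0 <= j < L) \sum_(0 <= m < j) u (m, (j.-1 - m)%N) : R[i]^o)
    @[L --> \oo] --> (l : R[i]^o).
Proof.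
move=> ul.
have := @has_csum_seq _ _ u l (fun L =>
  [seq (m, (j.-1 - m)%N) | j <- index_iota 0 L, m <- index_iota 0 j]) ul.
under [in X in _ -> _ -> X]eq_fun do rewrite big_allpairs_dep.
apply.
  move=> L; apply: allpairs_uniq_dep; rewrite ?iota_uniq//.
    by move=> j _; rewrite iota_uniq.
  move=> [a b] [c d] /= /allpairsPdep[j [m [_ + [-> ->]]]].
  rewrite mem_index_iota /= => mj.
  move=> /allpairsPdep[j' [m' [_ + [-> ->]]]].
  rewrite mem_index_iota /= => mj' [mm jj].
  have -> : j = j' by move: jj; rewrite -mm; lia.
  by rewrite mm.
move=> [m n]; exists (m + n).+2 => L Ln; apply/allpairsPdep.
exists (m + n).+1, m; rewrite !mem_index_iota; split => //; try lia.
by congr (_, _); lia.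
Qed.

(** The [half_tail] sum is reversed by [m] to [j.-1 - m]. With [n = j.-1 - m], all three residue
    conditions then say that [N] divides [2 * j - m]. *)
Lemma sum_tails_diag (R : realType) (N j : nat) :
  \sum_(0 <= m < j) (half_tail R N j m + int_tail R N j m) =
  \sum_(0 <= m < j) (if mod_anti N m (j.-1 - m)
    then (m.+1%:R)^-1 + ((j.-1 - m)%:R + 1 / 2)^-1 else 0).
Proof.
pose H m : R := if (N %| m + j.+1)%N then (m%:R + 1 / 2)^-1 else 0.
transitivity (\sum_(0 <= m < j) (H (j.-1 - m)%N + int_tail R N j m)).
  rewrite !big_split/=; congr (_ + _).
  rewrite big_nat_rev/=; apply: eq_big_nat => m /andP[_ mj].
  by rewrite /half_tail /H add0n (_ : j - m.+1 = j.-1 - m)%N//; lia.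
apply: eq_big_nat => m /andP[_ mj].
rewrite /H /int_tail mod_antiE natr1.
have E1 : (m + (2 * (j.-1 - m) + 1).+1 = 2 * j - m)%N by lia.
have E2 : (j.-1 - m + j.+1 = 2 * j - m)%N by lia.
have E3 : (m == 2 * j %[mod N]) = (N %| 2 * j - m)%N.
  by rewrite eq_sym eqn_mod_dvd//; lia.
rewrite E1 E2 E3; case: ifP => _; last by rewrite addr0.
by rewrite addrC.
Qed.

(** The indices with [N %| 2 * j + 1] are [j = (N - 1) %/ 2 + N * t]; there the sine vanishes and
    [j + 1 / 2 = N * (t + 1 / 2)], which gives the first series. The other indices give the sine
    series. *)
Lemma sum_row_coef (R : realType) (x : R[i]) (N k T : nat) : odd N ->
  \sum_(0 <= j < N * T) x ^+ j * (row_coef R N k j)%:C =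
  x ^+ ((N - 1) %/ 2) / N%:R ^+ (k + 2)
    * \sum_(0 <= t < T) x ^+ (N * t) / (t%:R + 1 / 2) ^+ (k + 2)
  + (pi / N%:R : R)%:C * \sum_(0 <= j < N * T)
     restr1 (fun m => ~~ (N %| 2 * m + 1)%N) (fun m =>
      x ^+ m / ((sin ((2 * m + 1)%:R * pi / N%:R : R))%:C
              * (m%:R + 1 / 2) ^+ (k + 1))) j.
Proof.
move=> oN; have N0 : (0 < N)%N by case: N oN.
have N1 : N%:R != 0 :> R[i] by rewrite pnatr_eq0 -lt0n.
pose G j : R[i] := x ^+ j / (j%:R + 1 / 2) ^+ (k + 2).
have -> : x ^+ ((N - 1) %/ 2) / N%:R ^+ (k + 2)
    * \sum_(0 <= t < T) x ^+ (N * t) / (t%:R + 1 / 2) ^+ (k + 2) =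
    \sum_(0 <= t < T) G ((N - 1) %/ 2 + N * t)%N.
  rewrite big_distrr/=; apply: eq_bigr => t _; rewrite /G.
  have -> : ((N - 1) %/ 2 + N * t)%:R + 1 / 2 = N%:R * (t%:R + 1 / 2) :> R[i].
    have NE : N%:R = 2 * ((N - 1) %/ 2)%:R + 1 :> R[i].
      rewrite -natrM natr1; congr _%:R.
      by rewrite -[LHS](odd_double_half N) oN; lia.
    by rewrite natrD natrM NE; field.
  by rewrite exprMn (exprD x) invfM [LHS]mulrACA.
rewrite -(@big_nat_class _ G N ((N - 1) %/ 2) T); last by lia.
rewrite big_distrr/= -big_split/=; apply: eq_bigr => j _.
rewrite -dvdn_double_class// /restr1 /row_coef /G.
have aE (q : nat) : (j%:R + 1 / 2) ^+ q = (((j%:R + 1 / 2) ^+ q : R)%:C).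
  by rewrite !(rmorphXn, rmorphD, rmorphM, fmorphV, rmorph1, rmorph_nat).
case: ifPn => Nj /=.
  have [q qE] := dvdnP Nj.
  have -> : sin ((2 * j + 1)%:R * pi / N%:R) = 0 :> R.
    rewrite qE natrM mulrAC mulfK ?sin_nat_pi//.
    by rewrite pnatr_eq0 -lt0n.
  rewrite invr0 mulr0 add0r mulr0 addr0 -invfM -exprSr -addnS aE.
  by rewrite fmorphV.
rewrite addr0 add0r aE.
by rewrite !(rmorphM, fmorphV) invfM; ring.
Qed.

(** Partial fractions with [a = n + 1 / 2], and with [b = m + 1 / 2] for the first two families and
    [b = m + 1] for the other two. *)
Lemma sum_first_terms (R : realType) (x : R[i]) (N k m n : nat) :
  \sum_(1 <= nu < k.+1) restr2 (mod_diag N) (fun m n =>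
      x ^+ n / ((n%:R + 1 / 2) ^+ nu * (m + n + 1)%:R ^+ (k + 2 - nu))) (m, n)
  + restr2 (mod_diag N) (fun m n =>
      x ^+ n / ((m%:R + 1 / 2) * (m + n + 1)%:R ^+ (k + 1))) (m, n)
  + \sum_(1 <= nu < k.+1) restr2 (mod_anti N) (fun m n =>
      x ^+ n / ((n%:R + 1 / 2) ^+ nu
        * ((m + n)%:R + 3 / 2) ^+ (k + 2 - nu))) (m, n)
  + restr2 (mod_anti N) (fun m n =>
      x ^+ n / ((m + 1)%:R * ((m + n)%:R + 3 / 2) ^+ (k + 1))) (m, n)
  = x ^+ n * ((((n%:R + 1 / 2) ^+ (k + 1))^-1 * row_term R N n m : R)%:C).
Proof.
have half0 (q : nat) : 0 < q%:R + 1 / 2 :> R[i].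
  by rewrite ltr_wpDl// divr_gt0.
have K (P : bool) (b c : R[i]) : 0 < b -> c = b + (n%:R + 1 / 2) ->
    \sum_(1 <= nu < k.+1)
      (if P then x ^+ n / ((n%:R + 1 / 2) ^+ nu * c ^+ (k + 2 - nu)) else 0)
    + (if P then x ^+ n / (b * c ^+ (k + 1)) else 0)
    = x ^+ n * (((n%:R + 1 / 2) ^+ (k + 1))^-1
        * (if P then b^-1 - c^-1 else 0)).
  move=> b0 ->; case: P; last by rewrite big1// addr0 !mulr0.
  rewrite -big_distrr/= -mulrDr sum_partial_fractions//.
  - exact: lt0r_neq0 b0.
  - exact: lt0r_neq0 (addr_gt0 b0 (half0 n)).
rewrite -addrA /restr2/= !K//; last 2 first.
- by rewrite !natrD; field.
- by rewrite !natrD; field.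
rewrite -!mulrDr; congr (_ * _); rewrite rmorphM; congr (_ * _).
  by rewrite !(rmorphXn, rmorphD, rmorphM, fmorphV, rmorph1, rmorph_nat).
rewrite /row_term [RHS]rmorphD; congr (_ + _).
- case: ifP => _; last by rewrite rmorph0.
  rewrite rmorphB.
  by rewrite !(rmorphXn, rmorphD, rmorphM, fmorphV, rmorph1, rmorph_nat).
- case: ifP => _; last by rewrite rmorph0.
  rewrite rmorphB.
  by rewrite !(rmorphXn, rmorphD, rmorphM, fmorphV, rmorph1, rmorph_nat).
Qed.

(** On the diagonal [m + n + 1 = j] the factor [m + n + 3 / 2] is the constant [j + 1 / 2], so only
    the sum of [sum_tails_diag] remains. *)
Lemma sum_last_terms (R : realType) (x : R[i]) (N k j : nat) :
  \sum_(0 <= m < j)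
    (restr2 (mod_anti N) (fun m n =>
       x ^+ (m + n + 1) / ((m + 1)%:R * ((m + n)%:R + 3 / 2) ^+ (k + 1)))
       (m, (j.-1 - m)%N)
     + restr2 (mod_anti N) (fun m n =>
       x ^+ (m + n + 1)
         / ((n%:R + 1 / 2) * ((m + n)%:R + 3 / 2) ^+ (k + 1)))
       (m, (j.-1 - m)%N))
  = x ^+ j * (row_diag R N k j)%:C.
Proof.
rewrite /row_diag sum_tails_diag rmorphM rmorph_sum mulrA big_distrr/=.
apply: eq_big_nat => m /andP[_ mj]; rewrite /restr2/=.
have -> : (m + (j.-1 - m) + 1 = j)%N by lia.
have -> : (m + (j.-1 - m))%:R + 3 / 2 = j%:R + 1 / 2 :> R[i].
  have {2}-> : (j = (m + (j.-1 - m)) + 1)%N by lia.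
  by rewrite [in RHS]natrD; field.
case: ifP => _; last by rewrite addr0 rmorph0 mulr0.
have -> : (((j%:R + 1 / 2) ^+ (k + 1))^-1 : R)%:C =
    ((j%:R + 1 / 2) ^+ (k + 1))^-1 :> R[i].
  by rewrite !(rmorphXn, rmorphD, rmorphM, fmorphV, rmorph1, rmorph_nat).
have -> : (m.+1%:R^-1 + ((j.-1 - m)%:R + 1 / 2)^-1 : R)%:C =
    m.+1%:R^-1 + ((j.-1 - m)%:R + 1 / 2)^-1 :> R[i].
  by rewrite !(rmorphXn, rmorphD, rmorphM, fmorphV, rmorph1, rmorph_nat).
by rewrite [(m + 1)%N]addn1 !invfM; ring.
Qed.

Lemma has_csum_nat (R : realType) (u : nat -> R[i]) l : has_csum u l ->
  (\sum_(0 <= n < L) u n : R[i]^o) @[L --> \oo] --> (l : R[i]^o).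
Proof.
move=> ul; apply: (has_csum_seq ul).
- by move=> n; exact: iota_uniq.
- by move=> m; exists m.+1 => n mn; rewrite mem_index_iota.
Qed.

Theorem theorem4p3 (R : realType) (N : nat) (hN : odd N) (k : nat)
    (hk : (0 < k)%N) (x : R[i]) (hx : `|x| <= 1) :
  let A1 (nu : nat) := restr2 (mod_diag N) (fun m n =>
    x ^+ n / ((n%:R + 1 / 2) ^+ nu * (m + n + 1)%:R ^+ (k + 2 - nu))) in
  let A2 := restr2 (mod_diag N) (fun m n =>
    x ^+ n / ((m%:R + 1 / 2) * (m + n + 1)%:R ^+ (k + 1))) in
  let B1 (nu : nat) := restr2 (mod_anti N) (fun m n =>
    x ^+ n / ((n%:R + 1 / 2) ^+ nu * ((m + n)%:R + 3 / 2) ^+ (k + 2 - nu))) in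
  let B2 := restr2 (mod_anti N) (fun m n =>
    x ^+ n / ((m + 1)%:R * ((m + n)%:R + 3 / 2) ^+ (k + 1))) in
  let B3 := restr2 (mod_anti N) (fun m n =>
    x ^+ (m + n + 1) / ((m + 1)%:R * ((m + n)%:R + 3 / 2) ^+ (k + 1))) in
  let B4 := restr2 (mod_anti N) (fun m n =>
    x ^+ (m + n + 1) /
      ((n%:R + 1 / 2) * ((m + n)%:R + 3 / 2) ^+ (k + 1))) in
  let C1 : nat -> R[i] := fun n => x ^+ (N * n) / (n%:R + 1 / 2) ^+ (k + 2) in
  let C2 := restr1 (fun m => ~~ (N %| 2 * m + 1)%N) (fun m =>
    x ^+ m / ((sin ((2 * m + 1)%:R * pi / N%:R : R))%:C
              * (m%:R + 1 / 2) ^+ (k + 1))) in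
  ((forall nu, (1 <= nu <= k)%N -> csummable (A1 nu) /\ csummable (B1 nu)) /\
   [/\ csummable A2, csummable B2, csummable B3 & csummable B4] /\
   csummable C1 /\ csummable C2) /\
  \sum_(1 <= nu < k.+1) csum (A1 nu) + csum A2
  + \sum_(1 <= nu < k.+1) csum (B1 nu) + csum B2
  - csum B3 - csum B4
  = x ^+ ((N - 1) %/ 2) / N%:R ^+ (k + 2) * csum C1
    + (pi / N%:R : R)%:C * csum C2.
Proof.
move=> A1 A2 B1 B2 B3 B4 C1 C2.
have realE := (rmorphXn, rmorphD, rmorphM, fmorphV, rmorph1, rmorph_nat).
have n0 (n : nat) : 0 <= n%:R :> R by [].
have N0 : (0 < N)%N by case: (N) hN.
have sA1 nu : (1 <= nu <= k)%N -> csummable (A1 nu).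
  move=> /andP[nu1 nuk].
  (* The denominator is exhibited as an embedded real number, the form treated by
     [csummable_term_row]. *)
  rewrite /A1 (@eq_restr2 _ _ _ (fun m n => x ^+ n /
    ((n%:R + 1 / 2) ^+ nu * (m + n).+1%:R ^+ (k + 2 - nu) : R)%:C)).
    apply: csummable_term_row => //; first by lia.
    by move=> m n; rewrite -[n.+1%:R]natr1; have := n0 n; lra.
  by move=> m n; rewrite addn1 !realE.
have sB1 nu : (1 <= nu <= k)%N -> csummable (B1 nu).
  move=> /andP[nu1 nuk].
  rewrite /B1 (@eq_restr2 _ _ _ (fun m n => x ^+ n /
    ((n%:R + 1 / 2) ^+ nu * ((m + n)%:R + 3 / 2) ^+ (k + 2 - nu) : R)%:C)).
    apply: csummable_term_row => //; first by lia.
      by move=> m n; rewrite -[(m + n).+1%:R]natr1; lra.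
    by move=> m n; rewrite -[n.+1%:R]natr1; have := n0 n; lra.
  by move=> m n; rewrite !realE.
have sA2 : csummable A2.
  rewrite /A2 (@eq_restr2 _ _ _ (fun m n => x ^+ n /
    ((m%:R + 1 / 2) ^+ 1 * (m + n).+1%:R ^+ (k + 1) : R)%:C)).
    apply: csummable_term_col => //; first by lia.
    by move=> m n; rewrite -[m.+1%:R]natr1; have := n0 m; lra.
  by move=> m n; rewrite addn1 expr1 !realE.
have sB2 : csummable B2.
  rewrite /B2 (@eq_restr2 _ _ _ (fun m n => x ^+ n /
    (m.+1%:R ^+ 1 * ((m + n)%:R + 3 / 2) ^+ (k + 1) : R)%:C)).
    apply: csummable_term_col => //; first by lia.
      by move=> m n; rewrite -[(m + n).+1%:R]natr1; lra.
    by move=> m n; rewrite -[m.+1%:R]natr1; have := n0 m; lra.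
  by move=> m n; rewrite [(m + 1)%N]addn1 expr1 !realE.
have sB3 : csummable B3.
  rewrite /B3 (@eq_restr2 _ _ _ (fun m n => x ^+ (m + n + 1) /
    (m.+1%:R ^+ 1 * ((m + n)%:R + 3 / 2) ^+ (k + 1) : R)%:C)).
    apply: csummable_term_col => //; first by lia.
      by move=> m n; rewrite -[(m + n).+1%:R]natr1; lra.
    by move=> m n; rewrite -[m.+1%:R]natr1; have := n0 m; lra.
  by move=> m n; rewrite [(m + 1)%N]addn1 expr1 !realE.
have sB4 : csummable B4.
  rewrite /B4 (@eq_restr2 _ _ _ (fun m n => x ^+ (m + n + 1) /
    ((n%:R + 1 / 2) ^+ 1 * ((m + n)%:R + 3 / 2) ^+ (k + 1) : R)%:C)).
    apply: csummable_term_row => //; first by lia.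
      by move=> m n; rewrite -[(m + n).+1%:R]natr1; lra.
    by move=> m n; rewrite -[n.+1%:R]natr1; have := n0 n; lra.
  by move=> m n; rewrite expr1 !realE.
have sC1 : csummable C1 by exact: csummable_half_pow.
have sC2 : csummable C2 by exact: csummable_sin.
split; first by split; [move=> nu nuk; split; [exact: sA1|exact: sB1]|].
have first_terms m n : \sum_(1 <= nu < k.+1) A1 nu (m, n) + A2 (m, n)
     + \sum_(1 <= nu < k.+1) B1 nu (m, n) + B2 (m, n)
   = x ^+ n * ((((n%:R + 1 / 2) ^+ (k + 1))^-1 * row_term R N n m : R)%:C).
  exact: sum_first_terms.
have last_terms j : \sum_(0 <= m < j)
    (B3 (m, (j.-1 - m)%N) + B4 (m, (j.-1 - m)%N))
  = x ^+ j * (row_diag R N k j)%:C by exact: sum_last_terms.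
have right_side T : \sum_(0 <= j < N * T) x ^+ j * (row_coef R N k j)%:C =
  x ^+ ((N - 1) %/ 2) / N%:R ^+ (k + 2) * \sum_(0 <= t < T) C1 t
  + (pi / N%:R : R)%:C * \sum_(0 <= j < N * T) C2 j by exact: sum_row_coef.
(* From here on the families enter only through their summability and the three identities just
   established. *)
clearbody A1 A2 B1 B2 B3 B4 C1 C2.
have head := has_csumD (has_csumD (has_csumD
  (has_csum_sum (a := 1) (b := k.+1)
     (fun nu nuk => csummable_has_csum (sA1 nu nuk)))
  (csummable_has_csum sA2))
  (has_csum_sum (a := 1) (b := k.+1)
     (fun nu nuk => csummable_has_csum (sB1 nu nuk))))
  (csummable_has_csum sB2).
have tail := has_csumD (csummable_has_csum sB3) (csummable_has_csum sB4).
(* The sum of row [n] of the first four families, by [cvg_row]. *)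
pose v n : R[i] := x ^+ n * (row_coef R N k n + row_diag R N k n)%:C.
have rows n : (\sum_(0 <= m < N * 2 ^ i)
    (\sum_(1 <= nu < k.+1) A1 nu (m, n) + A2 (m, n)
     + \sum_(1 <= nu < k.+1) B1 nu (m, n) + B2 (m, n)) : R[i]^o)
    @[i --> \oo] --> (v n : R[i]^o).
  under eq_fun do under eq_bigr do rewrite first_terms.
  under eq_fun do rewrite -big_distrr/= -rmorph_sum -big_distrr/=.
  apply: (@cvgZr _ R[i]^o); apply: cvg_real_complex.
  by rewrite /row_coef /row_diag -mulrDr; apply: cvgMr; exact: cvg_row.
have lim1 := has_csum_rows head (cvg_muln_expn N0) rows.
have lim2 := cvg_triangle tail.
have Noo : (fun i => (N * i)%N) @ \oo --> \oo.
  apply/cvgnyPge => A; near=> i.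
  have Ai : (A <= i)%N by near: i; exact: nbhs_infty_ge.
  by rewrite (leq_trans Ai)// leq_pmull.
(* Subtracting the last two families, grouped by diagonals, removes exactly the [row_diag] part of
   each row. *)
have diffE L : (\sum_(0 <= j < L) x ^+ j * (row_coef R N k j)%:C : R[i]^o) =
    \sum_(0 <= n < L) v n - \sum_(0 <= j < L) \sum_(0 <= m < j)
      (B3 (m, (j.-1 - m)%N) + B4 (m, (j.-1 - m)%N)).
  rewrite -[RHS]sumrB; apply: eq_bigr => j _.
  by rewrite last_terms /v rmorphD mulrDr addrK.
have lim0 : (\sum_(0 <= j < L) x ^+ j * (row_coef R N k j)%:C : R[i]^o)
    @[L --> \oo]
    --> (\sum_(1 <= nu < k.+1) csum (A1 nu) + csum A2
      + \sum_(1 <= nu < k.+1) csum (B1 nu) + csum B2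
      - (csum B3 + csum B4) : R[i]^o).
  rewrite (funext diffE); exact: (cvgB lim1 lim2).
(* Along lengths [N * i] the partial sums split exactly as in [sum_row_coef]; both sides are then
   limits of one sequence. *)
have lim := cvg_comp _ _ Noo lim0.
have limC1 := has_csum_nat (csummable_has_csum sC1).
have limC2 := cvg_comp _ _ Noo (has_csum_nat (csummable_has_csum sC2)).
have lim' : (\sum_(0 <= j < N * i) x ^+ j * (row_coef R N k j)%:C : R[i]^o)
    @[i --> \oo]
    --> (x ^+ ((N - 1) %/ 2) / N%:R ^+ (k + 2) * csum C1
         + (pi / N%:R : R)%:C * csum C2 : R[i]^o).
  under eq_fun do rewrite right_side.
  exact: (cvgD (@cvgZr _ R[i]^o _ _ _ _ _ _ limC1)
    (@cvgZr _ R[i]^o _ _ _ _ _ _ limC2)).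
rewrite -addrA -opprD.
by rewrite -(cvg_lim (@norm_hausdorff _ R[i]^o) lim)
  (cvg_lim (@norm_hausdorff _ R[i]^o) lim').
Unshelve. all: by end_near. Qed.
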